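(* Let $\mathbb{K}$ be a field and let $L$ be a $3$-Lie algebra over $\mathbb{K}$ such that the Lie algebra $\mathrm{InnDer}(L)$ of inner derivations of $L$ is not abelian. If $\dim_{\mathbb{K}} Z(L)\geq 2$, then $(\Lambda^{2}L,\circ)$ is not a Lie algebra.
   Context: The field $\mathbb{K}$ has characteristic different from $2$. A $3$-Lie algebra over $\mathbb{K}$ is a $\mathbb{K}$-vector space $L$ with a trilinear alternating bracket $[-,-,-]\colon L^3\to L$ (it vanishes whenever two of its arguments are equal) satisfying $$\big[[x_1,x_2,x_3],y_1,y_2\big]=\big[[x_1,y_1,y_2],x_2,x_3\big]+\big[x_1,[x_2,y_1,y_2],x_3\big]+\big[x_1,x_2,[x_3,y_1,y_2]\big]$$ for all $x_i,y_i\in L$. For $x=x_1\wedge x_2\in\Lambda^2L$ the adjoint action $\mathrm{ad}_x\colon L\to L$ is $\mathrm{ad}_x(b)=[x_1,x_2,b]$, extended linearly to all $x\in\Lambda^{2}L$. Each $\mathrm{ad}_x$ is a derivation of $L$, called an inner derivation; $\mathrm{InnDer}(L)$ is the space spanned by all of them, a Lie algebra under the commutator $[d_1,d_2]=d_1d_2-d_2d_1$. The centre of $L$ is $Z(L)=\{z\in L\mid \mathrm{ad}_x(z)=0\text{ for all }x\in\Lambda^2L\}$. The same notation $\mathrm{ad}_x$ is used for the extension by derivation to $\Lambda^2L$: $\mathrm{ad}_x(y_1\wedge y_2)=\mathrm{ad}_x(y_1)\wedge y_2+y_1\wedge\mathrm{ad}_x(y_2)$. The product $\circ$ on $\Lambda^{2}L$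 is the bilinear operation $$x\circ y=\tfrac12\bigl(\mathrm{ad}_x(y)-\mathrm{ad}_y(x)\bigr).$$ ''$(\Lambda^{2}L,\circ)$ is a Lie algebra'' means that $\circ$, as bracket, makes $\Lambda^{2}L$ a Lie algebra over $\mathbb{K}$. *)

(* Defs.v *)
From HB Require Import structures.
From mathcomp Require Import all_boot all_order all_algebra finmap.
From mathcomp.classical Require Import all_classical.
From mathcomp.multinomials Require Import monalg.

Set Implicit Arguments.
Unset Strict Implicit.
Unset Printing Implicit Defensive.

Import GRing.Theory Quotient.

Local Open Scope classical_set_scope.
Local Open Scope ring_scope.
Local Open Scope quotient_scope.

Section LinearAlgebra.
Variables (K : fieldType) (V : lmodType K).
Implicit Types A B : set V.

Definition lspan A : set V :=
  [set v | exists n (a : 'I_n -> K) (u : 'I_n -> V),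
    (forall i, A (u i)) /\ v = \sum_i a i *: u i].

Definition lin_indep A : Prop :=
  forall n (a : 'I_n -> K) (u : 'I_n -> V),
    injective u -> (forall i, A (u i)) ->
    \sum_i a i *: u i = 0 -> forall i, a i = 0.

Definition is_basis A B : Prop := lin_indep B /\ lspan B = A.

(* [dim A >= n]: the dimension is the cardinality of a basis, finite or not. *)
Definition dim_ge A (n : nat) : Prop :=
  exists2 B, is_basis A B & (`I_n #<= B)%card.

Lemma lspan_sub A : A `<=` lspan A.
Proof.
move=> v Av; exists 1%N, (fun=> 1), (fun=> v); split => //.
by rewrite big_ord1 scale1r.
Qed.

Lemma lspan0 A : lspan A 0.
Proof. by exists 0%N, (fun=> 0), (fun=> 0); split=> [[]//|]; rewrite big_ord0. Qed.

Lemma lspanD A u v : lspan A u -> lspan A v -> lspan A (u + v).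
Proof.
move=> [n [a [x [Ax ->]]]] [m [b [y [Ay ->]]]].
exists (n + m)%N,
  (fun i : 'I_(n + m) => match fintype.split i with inl j => a j | inr j => b j end),
  (fun i : 'I_(n + m) => match fintype.split i with inl j => x j | inr j => y j end); split.
  by move=> i; case: (fintype.split i).
rewrite big_split_ord /=; congr (_ + _); apply: eq_bigr => i _.
  by rewrite -[lshift m i]/(unsplit (inl i)) unsplitK.
by rewrite -[rshift n i]/(unsplit (inr i)) unsplitK.
Qed.

Lemma lspanZ A c u : lspan A u -> lspan A (c *: u).
Proof.
move=> [n [a [x [Ax ->]]]]; exists n, (fun i => c * a i), x; split=> //.
by rewrite scaler_sumr; apply: eq_bigr => i _; rewrite scalerA.
Qed.

Lemma linear_fun0 (W : lmodType K) (f : V -> W) : linear f -> f 0 = 0.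
Proof.
by move=> lf; have := lf (-1) 0 0; rewrite scaler0 addr0 scaleN1r addNr.
Qed.

End LinearAlgebra.

Definition is_lie_algebra (K : fieldType) (V : lmodType K) (br : V -> V -> V)
    : Prop :=
  [/\ forall y, linear (br ^~ y), forall x, linear (br x),
      forall x, br x x = 0 &
      forall x y z, br x (br y z) + br y (br z x) + br z (br x y) = 0].

(* Endomorphisms are plain functions; [V -> V] is a vector space pointwise. *)
Definition commutator (K : fieldType) (V : lmodType K) (d1 d2 : V -> V)
  : V -> V := (d1 \o d2) - (d2 \o d1).

Definition is_abelian (K : fieldType) (V : lmodType K) (br : V -> V -> V)
  (A : set V) : Prop := forall x y, A x -> A y -> br x y = 0.

Fact ext2_key : unit. Proof. by []. Qed.

Section Ext2.
Variables (K : fieldType) (L : lmodType K).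

Local Notation free := {malg K[(L * L)%type]}.
Local Notation "e( x , y )" := (<< (x, y) >> : free) (format "e( x ,  y )").

Inductive ext2_rel : set free :=
| Ext2Dl x x' y : ext2_rel (e(x + x', y) - e(x, y) - e(x', y))
| Ext2Dr x y y' : ext2_rel (e(x, y + y') - e(x, y) - e(x, y'))
| Ext2Zl a x y : ext2_rel (e(a *: x, y) - a *: e(x, y))
| Ext2Zr a x y : ext2_rel (e(x, a *: y) - a *: e(x, y))
| Ext2xx x : ext2_rel e(x, x).

Definition ext2_ideal : pred free := fun g => `[< lspan ext2_rel g >].

Lemma ext2_idealP g : (g \in ext2_ideal) <-> lspan ext2_rel g.
Proof. by split=> /asboolP. Qed.

Lemma ext2_ideal_zmod_closed : zmod_closed ext2_ideal.
Proof.
split=> [|u v /ext2_idealP su /ext2_idealP sv]; apply/ext2_idealP.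
  exact: lspan0.
by apply: lspanD => //; rewrite -scaleN1r; exact: lspanZ.
Qed.

HB.instance Definition _ :=
  GRing.isZmodClosed.Build free ext2_ideal ext2_ideal_zmod_closed.

Definition ext2_zmod : zmodClosed free :=
  GRing.ZmodClosed.clone free ext2_ideal _.

(* [Λ²L]: the free vector space on [L * L] modulo the subspace spanned by the
   relations making [(x, y)] bilinear and alternating. *)
Definition ext2 : Type := {quot ext2_zmod}.
HB.instance Definition _ := GRing.Zmodule.on ext2.
HB.instance Definition _ := EqQuotient.on ext2.

Definition ext2_proj (g : free) : ext2 := \pi_{quot ext2_zmod} g.

(* Locked, lest unification unfold the quotient: see [ext2_scaleE], [wedgeE]
   and [ext2_liftE]. *)
Definition ext2_scale : K -> ext2 -> ext2 :=
  locked_with ext2_key (fun a x => ext2_proj (a *: repr x)).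

Definition wedge : L -> L -> ext2 :=
  locked_with ext2_key (fun x y => ext2_proj e(x, y)).

Lemma ext2_scaleE a x : ext2_scale a x = ext2_proj (a *: repr x).
Proof. by rewrite [ext2_scale]locked_withE. Qed.

Lemma wedgeE x y : wedge x y = ext2_proj e(x, y).
Proof. by rewrite [wedge]locked_withE. Qed.

Lemma ext2_projP g h : ext2_proj g = ext2_proj h <-> lspan ext2_rel (g - h).
Proof.
rewrite -ext2_idealP /ext2_proj; split.
  by move=> /eqP; rewrite -idealrBE.
by move=> gh; apply/eqP; rewrite -idealrBE.
Qed.

Lemma ext2_reprK (x : ext2) : ext2_proj (repr x) = x.
Proof. exact: reprK. Qed.

Lemma ext2_projD : {morph ext2_proj : g h / g + h}.
Proof. exact: raddfD. Qed.

Lemma ext2_proj_scale a g : ext2_scale a (ext2_proj g) = ext2_proj (a *: g).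
Proof.
rewrite ext2_scaleE; apply/ext2_projP; rewrite -scalerBr; apply: lspanZ; apply/ext2_projP.
exact: ext2_reprK.
Qed.

Fact ext2_scaleA a b x : ext2_scale a (ext2_scale b x) = ext2_scale (a * b) x.
Proof.
by rewrite -(ext2_reprK x) !ext2_proj_scale scalerA.
Qed.

Fact ext2_scale1 : left_id 1 ext2_scale.
Proof. by move=> x; rewrite ext2_scaleE scale1r ext2_reprK. Qed.

Fact ext2_scaleDr : right_distributive ext2_scale +%R.
Proof.
move=> a x y; rewrite -(ext2_reprK x) -(ext2_reprK y) -ext2_projD.
by rewrite !ext2_proj_scale scalerDr ext2_projD.
Qed.

Fact ext2_scaleDl x : {morph ext2_scale^~ x : a b / a + b}.
Proof.
by move=> a b; rewrite -(ext2_reprK x) !ext2_proj_scale scalerDl ext2_projD.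
Qed.

HB.instance Definition _ := GRing.Zmodule_isLmodule.Build K ext2
  ext2_scaleA ext2_scale1 ext2_scaleDr ext2_scaleDl.

Lemma ext2_proj_linear : linear ext2_proj.
Proof. by move=> a g h; rewrite ext2_projD -ext2_proj_scale. Qed.

HB.instance Definition _ :=
  GRing.isLinear.Build K free ext2 *:%R ext2_proj ext2_proj_linear.

Lemma wedge_linearl y : linear (wedge^~ y).
Proof.
move=> a x x'; rewrite !wedgeE -linearP /=; apply/ext2_projP.
have -> : e(a *: x + x', y) - (a *: e(x, y) + e(x', y)) =
  (e(a *: x + x', y) - e(a *: x, y) - e(x', y)) + (e(a *: x, y) - a *: e(x, y)).
  by rewrite [RHS]addrAC subrKA opprD addrA.
exact: lspanD (lspan_sub (Ext2Dl _ _ _)) (lspan_sub (Ext2Zl _ _ _)).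
Qed.

Lemma wedge_linearr x : linear (wedge x).
Proof.
move=> a y y'; rewrite !wedgeE -linearP /=; apply/ext2_projP.
have -> : e(x, a *: y + y') - (a *: e(x, y) + e(x, y')) =
  (e(x, a *: y + y') - e(x, a *: y) - e(x, y')) + (e(x, a *: y) - a *: e(x, y)).
  by rewrite [RHS]addrAC subrKA opprD addrA.
exact: lspanD (lspan_sub (Ext2Dr _ _ _)) (lspan_sub (Ext2Zr _ _ _)).
Qed.

Lemma wedgexx x : wedge x x = 0.
Proof.
rewrite wedgeE -[RHS](linear0 ext2_proj); apply/ext2_projP; rewrite subr0.
by apply: lspan_sub; exact: Ext2xx.
Qed.

(* [f] extended linearly from the [wedge x y] to [Λ²L]; meaningful when [f] is
   bilinear and alternating, see [ext2_lift_wedge] and [ext2_lift_linear]. *)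
Definition free_lift (V : lmodType K) (f : L -> L -> V) (g : free) : V :=
  \sum_(k <- msupp g) g@_k *: f k.1 k.2.

Definition ext2_lift (V : lmodType K) : (L -> L -> V) -> ext2 -> V :=
  locked_with ext2_key (fun f x => free_lift f (repr x)).

Section Lift.
Variables (V : lmodType K) (f : L -> L -> V).

Lemma ext2_liftE x : ext2_lift f x = free_lift f (repr x).
Proof. by rewrite [@ext2_lift V]locked_withE. Qed.

Lemma free_lift_linear : linear (free_lift f).
Proof.
move=> a g h.
have sE (d : {fset (L * L)%type}) (k : free) : (msupp k `<=` d)%fset ->
    free_lift f k = \sum_(i <- d) k@_i *: f i.1 i.2.
  move=> sd; rewrite /free_lift; apply: big_fset_incl => // i _ /mcoeff_outdom ->.
  by rewrite scale0r.
pose d := (msupp (a *: g + h) `|` (msupp g `|` msupp h))%fset.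
have [d1 d2 d3] : [/\ msupp (a *: g + h) `<=` d, msupp g `<=` d
    & msupp h `<=` d]%fset.
  by rewrite /d; split; apply/fsubsetP => i; rewrite !inE => ->; rewrite ?orbT.
rewrite !(sE d) //.
rewrite scaler_sumr -big_split /=; apply: eq_bigr => i _.
by rewrite mcoeffD mcoeffZ scalerDl scalerA.
Qed.

HB.instance Definition _ :=
  GRing.isLinear.Build K free V *:%R (free_lift f) free_lift_linear.

Lemma free_liftU x y : free_lift f e(x, y) = f x y.
Proof.
by rewrite /free_lift msuppU oner_eq0 big_seq_fset1 mcoeffUU scale1r.
Qed.

Hypotheses (fl : forall y, linear (f^~ y)) (fr : forall x, linear (f x)).
Hypothesis fxx : forall x, f x x = 0.

Lemma ext2_lift_proj g : ext2_lift f (ext2_proj g) = free_lift f g.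
Proof.
rewrite ext2_liftE; apply/eqP; rewrite -subr_eq0 -linearB; apply/eqP => /=.
have /ext2_projP [n [a [u [ru ->]]]] := ext2_reprK (ext2_proj g).
have flD y x x' : f (x + x') y = f x y + f x' y.
  by rewrite -[x]scale1r fl !scale1r.
have frD x y y' : f x (y + y') = f x y + f x y'.
  by rewrite -[y]scale1r fr !scale1r.
have fl0 y : f 0 y = 0 by apply: (addrI (f 0 y)); rewrite -flD !addr0.
have fr0 x : f x 0 = 0 by apply: (addrI (f x 0)); rewrite -frD !addr0.
rewrite linear_sum big1 // => i _; rewrite linearZ /=.
suff -> : free_lift f (u i) = 0 by rewrite scaler0.
case: (ru i) => [x x' y|x y y'|b x y|b x y|x].
- rewrite !linearB /= !free_liftU.
  by rewrite flD addrAC addrK subrr.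
- rewrite !linearB /= !free_liftU.
  by rewrite frD addrAC addrK subrr.
- rewrite linearB linearZ /= !free_liftU.
  by rewrite -[b *: x]addr0 fl fl0 addr0 subrr.
- rewrite linearB linearZ /= !free_liftU.
  by rewrite -[b *: y]addr0 fr fr0 addr0 subrr.
- by rewrite free_liftU fxx.
Qed.

Lemma ext2_lift_linear : linear (ext2_lift f).
Proof.
move=> a x y; rewrite -(ext2_reprK x) -(ext2_reprK y) -ext2_proj_linear.
by rewrite !ext2_lift_proj linearP.
Qed.

Lemma ext2_lift_wedge x y : ext2_lift f (wedge x y) = f x y.
Proof. by rewrite wedgeE ext2_lift_proj free_liftU. Qed.

End Lift.

Lemma ext2_ind (P : ext2 -> Prop) :
  P 0 -> (forall a x y z, P z -> P (a *: wedge x y + z)) -> forall x, P x.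
Proof.
move=> P0 Pa x; rewrite -(ext2_reprK x) (monalgE (repr x)) linear_sum /=.
elim/big_rec: _ => // -[y z] u _ Pu.
have -> : << (repr x)@_(y, z) *g (y, z) >> = (repr x)@_(y, z) *: e(y, z).
  by apply/malgP => k; rewrite mcoeffZ !mcoeffU mulr_natr.
by rewrite linearZ /= -wedgeE; exact: Pa.
Qed.

End Ext2.

HB.mixin Record Lmodule_isThreeLie (K : fieldType) L of GRing.Lmodule K L := {
  tbr : L -> L -> L -> L;
  tbr_linear1 : forall y z, linear (fun x => tbr x y z);
  tbr_linear2 : forall x z, linear (fun y => tbr x y z);
  tbr_linear3 : forall x y, linear (fun z => tbr x y z);
  tbr_alt12 : forall x z, tbr x x z = 0;
  tbr_alt13 : forall x y, tbr x y x = 0;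
  tbr_alt23 : forall x y, tbr x y y = 0;
  tbr_fundamental : forall x1 x2 x3 y1 y2,
    tbr (tbr x1 x2 x3) y1 y2 =
      tbr (tbr x1 y1 y2) x2 x3 + tbr x1 (tbr x2 y1 y2) x3
      + tbr x1 x2 (tbr x3 y1 y2)
}.

#[short(type="threeLieType")]
HB.structure Definition ThreeLie (K : fieldType) :=
  { L of GRing.Lmodule K L & Lmodule_isThreeLie K L }.

Section ThreeLieTheory.
Variables (K : fieldType) (L : threeLieType K).

Definition ad (x : ext2 L) (b : L) : L :=
  ext2_lift (fun x1 x2 => tbr x1 x2 b) x.

(* [ad x] acting on [Λ²L] by derivation. *)
Definition ad2 (x y : ext2 L) : ext2 L :=
  ext2_lift (fun y1 y2 => wedge (ad x y1) y2 + wedge y1 (ad x y2)) y.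

Definition circ (x y : ext2 L) : ext2 L := 2%:R^-1 *: (ad2 x y - ad2 y x).

Definition centre : set L := [set z | forall x : ext2 L, ad x z = 0].

Definition InnDer : set (L -> L) := lspan (range ad).

Lemma ad_wedge x1 x2 b : ad (wedge x1 x2) b = tbr x1 x2 b.
Proof.
apply: ext2_lift_wedge => *; [exact: tbr_linear1|exact: tbr_linear2|].
exact: tbr_alt12.
Qed.

Lemma ad_linearl b : linear (ad^~ b).
Proof.
apply: ext2_lift_linear => *; [exact: tbr_linear1|exact: tbr_linear2|].
exact: tbr_alt12.
Qed.

Lemma ad_linearr x : linear (ad x).
Proof.
move=> a b c; elim/ext2_ind: x => [|k x1 x2 x IH].
  have ad0 d : ad 0 d = 0 by exact: linear_fun0 (ad_linearl d).
  by rewrite !ad0 scaler0 addr0.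
rewrite !ad_linearl IH !ad_wedge tbr_linear3 !scalerDr !scalerA (mulrC k a).
by rewrite addrACA.
Qed.

Lemma ad2_form_linearl x y2 :
  linear (fun y1 => wedge (ad x y1) y2 + wedge y1 (ad x y2)).
Proof.
by move=> a y y'; rewrite ad_linearr !wedge_linearl scalerDr addrACA.
Qed.

Lemma ad2_form_linearr x y1 :
  linear (fun y2 => wedge (ad x y1) y2 + wedge y1 (ad x y2)).
Proof.
by move=> a y y'; rewrite ad_linearr !wedge_linearr scalerDr addrACA.
Qed.

Lemma ad2_form_alt x y : wedge (ad x y) y + wedge y (ad x y) = 0.
Proof.
have wD u v w : wedge (u + v) w = wedge u w + wedge v w.
  by rewrite -[u]scale1r wedge_linearl !scale1r.
have wDr u v w : wedge u (v + w) = wedge u v + wedge u w.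
  by rewrite -[v]scale1r wedge_linearr !scale1r.
have := wedgexx (ad x y + y).
by rewrite wD !wDr !wedgexx add0r addr0.
Qed.

Lemma ad2_wedge x y1 y2 :
  ad2 x (wedge y1 y2) = wedge (ad x y1) y2 + wedge y1 (ad x y2).
Proof.
rewrite /ad2 ext2_lift_wedge // => *; [exact: ad2_form_linearl|
  exact: ad2_form_linearr|exact: ad2_form_alt].
Qed.

Lemma ad2_linearr x : linear (ad2 x).
Proof.
apply: ext2_lift_linear => *; [exact: ad2_form_linearl|
  exact: ad2_form_linearr|exact: ad2_form_alt].
Qed.

Lemma ad2_linearl y : linear (ad2^~ y).
Proof.
move=> a x x'; elim/ext2_ind: y => [|k y1 y2 y IH].
  have ad20 z : ad2 z 0 = 0 by exact: linear_fun0 (ad2_linearr z).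
  by rewrite !ad20 scaler0 addr0.
rewrite !ad2_linearr IH !ad2_wedge !ad_linearl wedge_linearl wedge_linearr.
rewrite !scalerDr !scalerA (mulrC k a) [in RHS]addrACA; congr (_ + _).
by rewrite addrACA.
Qed.

Lemma circ_linearl y : linear (circ^~ y).
Proof.
move=> a x x'; rewrite /circ ad2_linearl ad2_linearr scalerA mulrC -scalerA.
by rewrite -scalerDr opprD addrACA -scalerBr.
Qed.

Lemma circ_linearr x : linear (circ x).
Proof.
move=> a y y'; rewrite /circ ad2_linearl ad2_linearr scalerA mulrC -scalerA.
by rewrite -scalerDr opprD addrACA -scalerBr.
Qed.

Lemma tbrC12 x y z : tbr y x z = - tbr x y z :> L.
Proof.
have D u v w t : tbr (u + v) w t = tbr u w t + tbr v w t :> L.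
  by rewrite -[u]scale1r tbr_linear1 !scale1r.
have E u v w t : tbr u (v + w) t = tbr u v t + tbr u w t :> L.
  by rewrite -[v]scale1r tbr_linear2 !scale1r.
have := tbr_alt12 (x + y) z.
by rewrite D !E !tbr_alt12 add0r addr0 addrC => /eqP; rewrite addr_eq0 => /eqP.
Qed.

Lemma tbrC23 x y z : tbr x z y = - tbr x y z :> L.
Proof.
have D u v w t : tbr u (v + w) t = tbr u v t + tbr u w t :> L.
  by rewrite -[v]scale1r tbr_linear2 !scale1r.
have E u v w t : tbr u v (w + t) = tbr u v w + tbr u v t :> L.
  by rewrite -[w]scale1r tbr_linear3 !scale1r.
have := tbr_alt23 x (y + z).
by rewrite D !E !tbr_alt23 add0r addr0 addrC => /eqP; rewrite addr_eq0 => /eqP.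
Qed.

Lemma tbr_rot x y z : tbr y z x = tbr x y z :> L.
Proof. by rewrite tbrC23 tbrC12 opprK. Qed.

Lemma ad_derivation x b1 b2 b3 : ad x (tbr b1 b2 b3) =
  tbr (ad x b1) b2 b3 + tbr b1 (ad x b2) b3 + tbr b1 b2 (ad x b3).
Proof.
elim/ext2_ind: x => [|k x1 x2 x IH].
  have ad0 b : ad 0 b = 0 by exact: linear_fun0 (ad_linearl b).
  have t1 u v : tbr 0 u v = 0 :> L by exact: linear_fun0 (tbr_linear1 u v).
  by rewrite !ad0 t1 [tbr b1 0 b3]tbrC12 -[tbr b1 b2 0]tbr_rot
    -[tbr b2 0 b1]tbr_rot !t1 oppr0 !addr0.
rewrite !ad_linearl !ad_wedge IH tbr_linear1 tbr_linear2 tbr_linear3.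
rewrite ![tbr x1 x2 _]tbr_rot tbr_fundamental !scalerDr.
by rewrite [in LHS]addrACA; congr (_ + _); rewrite addrACA.
Qed.

Lemma ad_ad2 x y : ad (ad2 x y) = commutator (ad x) (ad y).
Proof.
apply/funext => b; rewrite /commutator /=.
rewrite -[RHS]/(ad x (ad y b) - ad y (ad x b)).
elim/ext2_ind: y => [|k y1 y2 y IH].
  have ad0 c : ad 0 c = 0 by exact: linear_fun0 (ad_linearl c).
  have ad20 : ad2 x 0 = 0 by exact: linear_fun0 (ad2_linearr x).
  have adx0 : ad x 0 = 0 by exact: linear_fun0 (ad_linearr x).
  by rewrite ad20 !ad0 adx0 subrr.
rewrite ad2_linearr !ad_linearl IH ad2_wedge ad_linearr !ad_wedge.
rewrite opprD addrACA -scalerBr; congr (_ *: _ + _).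
rewrite ad_derivation addrK -[wedge (ad x y1) y2]scale1r ad_linearl scale1r.
by rewrite !ad_wedge.
Qed.

(* [ad] being linear, the span of its range is its range. *)
Lemma InnDerE : InnDer = range ad.
Proof.
apply/seteqP; split=> [d|]; last exact: lspan_sub.
move=> [n [a [u [ru ->]]]].
elim: n a u ru => [|n IH] a u ru.
  exists 0 => //; rewrite big_ord0; apply/funext => b.
  exact: linear_fun0 (ad_linearl b).
have [x _ xE] := IH (fun i => a (lift ord0 i)) (fun i => u (lift ord0 i))
  (fun i => ru _).
have [y _ yE] := ru ord0.
exists (a ord0 *: y + x) => //; rewrite big_ord_recl -xE -yE.
by apply/funext => b; exact: ad_linearl.
Qed.

Lemma InnDer_commutator d1 d2 :
  InnDer d1 -> InnDer d2 -> InnDer (commutator d1 d2).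
Proof.
rewrite InnDerE => -[x _ <-] [y _ <-]; rewrite -ad_ad2.
by exists (ad2 x y).
Qed.

End ThreeLieTheory.

(* Main.v *)
(** If [c] is central then [ad_(c /\ b) = 0], and the Jacobi identity for
    [x], [y] and [c /\ b] reduces to [c /\ [ad_x, ad_y] b = 0].  Hence
    [[ad_x, ad_y] b] lies on the line of every nonzero central [c]; two
    independent such [c] force [[ad_x, ad_y] = 0]. *)
Require Import Defs.
From HB Require Import structures.
From mathcomp Require Import all_boot all_order all_algebra.
From mathcomp.classical Require Import all_classical.

Set Implicit Arguments.
Unset Strict Implicit.
Unset Printing Implicit Defensive.

Local Open Scope ring_scope.

Import GRing.Theory.

Section LinearAlgebra.
Variables (K : fieldType) (V : lmodType K).

(** Zorn's lemma gives a maximal [H] among the sets closed under [a *: u + v] that miss [c];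
    maximality forces [H] and [c] to span [V]. *)
Lemma hyperplane_avoiding (c : V) : c != 0 ->
  exists2 H : set V, (forall a u v, H u -> H v -> H (a *: u + v)) /\ ~ H c &
    forall v, exists k, H (v - k *: c).
Proof.
move=> c0.
pose lin (H : set V) := forall a u v, H u -> H v -> H (a *: u + v).
have [|H [[Hlin Hc] Hmax]] := @Zorn_bigcup V [set H | lin H /\ ~ H c].
  move=> F FP Ftot; split=> [a u v [X FX Xu] [Y FY Yv]|[X FX]]; last first.
    by have [_] := FP X FX.
  have [XY|YX] := Ftot X Y FX FY.
    by exists Y => //; apply: (FP Y FY).1 => //; exact: XY.
  by exists X => //; apply: (FP X FX).1 => //; exact: YX.
(* The empty set, union of the empty chain, satisfies [lin], so [H] could a priori be empty.
   Comparison with [[set 0]], which misses the nonzero [c], excludes this. *)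
have H0 : H 0.
  apply: contrapT => H0; have Hempty u : ~ H u.
    by move=> Hu; apply: H0; rewrite -(addNr u) -scaleN1r; exact: Hlin.
  apply: (Hmax [set 0]%classic); first by split=> [u /Hempty|/(_ 0 erefl)/H0].
  split=> [a u v -> ->|/= cE]; first by rewrite scaler0 addr0.
  by rewrite cE eqxx in c0.
have HZ a u : H u -> H (a *: u) by move=> Hu; rewrite -[_ *: _]addr0; exact: Hlin.
exists H => // v; have [Hv|Hv] := pselect (H v).
  by exists 0; rewrite scale0r subr0.
(* [H'] is the sum of [H] and the line of [v]. By maximality it contains [c], say [c = h + k *: v];
   here [k] is nonzero because [H] misses [c], so the equation can be solved for [v]. *)
pose H' := [set w : V | exists k, H (w - k *: v)]%classic.
have H'lin : lin H'.
  move=> a u w [k Hk] [l Hl]; exists (a * k + l).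
  by rewrite scalerDl -scalerA opprD addrACA -scalerBr; exact: Hlin.
have [k Hk] : H' c.
  apply: contrapT => H'c; apply: (Hmax H'); last by split.
  split=> [u Hu|/(_ v) sub]; first by exists 0; rewrite scale0r subr0.
  by apply/Hv/sub; exists 1; rewrite scale1r subrr.
have k0 : k != 0.
  by apply/eqP => k0; apply: Hc; rewrite k0 scale0r subr0 in Hk.
exists k^-1; have := HZ (- k^-1) _ Hk.
by rewrite scalerBr scalerA mulNr mulVf // !scaleNr scale1r opprK addrC.
Qed.

(** [phi v] is the coefficient of [c] in [v] modulo [H]. As [H] meets the line of [c] only in 0,
    this coefficient is unique, and uniqueness yields linearity. *)
Lemma dual_vector (c : V) : c != 0 ->
  exists2 phi : V -> K, (forall a u v, phi (a *: u + v) = a * phi u + phi v) &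
    phi c = 1.
Proof.
move=> c0; have [H [Hlin Hc] /choice [phi Hphi]] := hyperplane_avoiding c0.
have H0 : H 0 by have := Hlin (-1) _ _ (Hphi c) (Hphi c); rewrite scaleN1r addNr.
have HZ a u : H u -> H (a *: u) by move=> Hu; rewrite -[_ *: _]addr0; exact: Hlin.
have Hline k : H (k *: c) -> k = 0.
  move=> Hk; apply/eqP/negPn/negP => k0; apply: Hc.
  by have := HZ k^-1 _ Hk; rewrite scalerA mulVf // scale1r.
have phiE v k : H (v - k *: c) -> phi v = k.
  move=> Hk; apply/eqP; rewrite -subr_eq0; apply/eqP/Hline.
  have := Hlin (-1) _ _ (Hphi v) Hk.
  by rewrite scaleN1r opprB addrA subrK scalerBl.
exists phi; last by apply: phiE; rewrite scale1r subrr.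
move=> a u v; apply: phiE.
by rewrite scalerDl -scalerA opprD addrACA -scalerBr; exact: Hlin.
Qed.

(* Applies the alternating map [x /\ y |-> phi x *: y - phi y *: x], where
   [phi c = 1]. *)
Lemma wedge_eq0_colinear (c v : V) : c != 0 -> wedge c v = 0 ->
  exists k, v = k *: c.
Proof.
move=> /dual_vector [phi phiD phic] cv0; exists (phi v).
pose f x y : V := phi x *: y - phi y *: x.
have fl y : linear (f^~ y).
  move=> a u w; rewrite /f phiD scalerDl scalerDr opprD addrACA.
  by rewrite [phi y *: (a *: u)]scalerA (mulrC (phi y)) -!scalerA -scalerBr.
have fC x y : f x y = - f y x by rewrite /f opprB.
have fr x : linear (f x).
  by move=> a u w; rewrite !(fC x) fl opprD scalerN.
have fxx x : f x x = 0 by rewrite /f subrr.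
have := ext2_lift_wedge fl fr fxx c v.
have -> : ext2_lift f (wedge c v) = 0.
  by rewrite cv0; exact: linear_fun0 (ext2_lift_linear fl fr fxx).
by rewrite /f phic scale1r => /esym/eqP; rewrite subr_eq0 => /eqP.
Qed.

(** The cardinality bound provides a map [f] from the basis onto [I_2], and [c], [d] are preimages
    of 0 and 1. Since [f] separates them, the family [u] is injective, as [lin_indep] demands. *)
Lemma dim_ge2_indep (A : set V) : dim_ge A 2 ->
  exists c d, [/\ A c, A d &
    forall a b, a *: c + b *: d = 0 -> a = 0 /\ b = 0].
Proof.
move=> [B [Bfree <-] /pfcard_geP [I0|/unsquash f]].
  by have : `I_2%classic 0%N by []; rewrite I0.
have [c Bc fc] := @surj _ _ _ _ f 0%N isT.
have [d Bd fd] := @surj _ _ _ _ f 1%N isT.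
exists c, d; split; [exact: lspan_sub..|move=> a b ab0].
pose s (i : 'I_2) := if i == ord0 then a else b.
pose u (i : 'I_2) := if i == ord0 then c else d.
have fu i : f (u i) = i.
  by case: i => [[|[|//]] ?]; rewrite /u /= ?fc ?fd.
have s0 : forall i, s i = 0.
  apply: (Bfree _ _ u).
  - by move=> i j /(congr1 f); rewrite !fu => /val_inj.
  - by move=> i; rewrite /u; case: ifP.
  - by rewrite big_ord_recl big_ord1.
by split; [exact: (s0 ord0)|exact: (s0 ord_max)].
Qed.

End LinearAlgebra.

HB.instance Definition _ (K : fieldType) (L : lmodType K) (x : L) :=
  GRing.isLinear.Build K L (ext2 L) *:%R (wedge x) (wedge_linearr x).

HB.instance Definition _ (K : fieldType) (L : threeLieType K) (x : ext2 L) :=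
  GRing.isLinear.Build K L L *:%R (ad x) (ad_linearr x).

Section CircTheory.
Variables (K : fieldType) (L : threeLieType K).
Implicit Types (b c : L) (x y : ext2 L).

Lemma circC x y : circ x y = - circ y x.
Proof. by rewrite /circ -scalerN opprB. Qed.

(** By [ad_ad2] and antisymmetry of the commutator, both terms of [circ] contribute equally, which
    cancels the factor 1/2. *)
Lemma ad_circ x y b : (2%:R : K) != 0 ->
  ad (circ x y) b = commutator (ad x) (ad y) b.
Proof.
move=> two_neq0; have ad0 : ad 0 b = 0 by exact: linear_fun0 (ad_linearl b).
rewrite /circ -[_ *: _]addr0 ad_linearl ad0 addr0 addrC -scaleN1r ad_linearl.
rewrite scaleN1r !ad_ad2 addrC.
apply: (scalerI two_neq0); rewrite scalerA divff // scale1r.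
by rewrite -[X in _ - X]opprB opprK scaler_nat mulr2n.
Qed.

(** Centrality concerns the last slot of the bracket; [tbr_rot] moves [c] there from the first. *)
Lemma ad_wedge_centre c b : centre c -> ad (wedge c b) = 0.
Proof.
by move=> Zc; apply/funext => u; rewrite ad_wedge -tbr_rot -ad_wedge; exact: Zc.
Qed.

Lemma ad2_wedge_centre_left c b x : centre c -> ad2 (wedge c b) x = 0.
Proof.
move=> Zc; elim/ext2_ind: x => [|k x1 x2 x IH].
  exact: linear_fun0 (ad2_linearr _).
rewrite ad2_linearr IH ad2_wedge ad_wedge_centre // linear0.
by rewrite (linear_fun0 (wedge_linearl _)) !addr0 scaler0.
Qed.

Lemma ad2_wedge_centre_right x c b : centre c ->
  ad2 x (wedge c b) = wedge c (ad x b).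
Proof.
by move=> Zc; rewrite ad2_wedge Zc (linear_fun0 (wedge_linearl _)) add0r.
Qed.

Lemma circ_wedge_centre x c b : centre c ->
  circ x (wedge c b) = wedge c (2%:R^-1 *: ad x b).
Proof.
move=> Zc.
by rewrite /circ ad2_wedge_centre_left // subr0 ad2_wedge_centre_right // linearZ.
Qed.

(** Each nested action on [wedge c b] carries 1/2 twice, so the first two Jacobi terms add up to [W]
    with coefficient 1/4. By [ad_circ] the third carries 1/2 only once, with a minus sign. The total
    -1/4 is nonzero. *)
Lemma jacobi_wedge_centre x y c b : (2%:R : K) != 0 -> centre c ->
  is_lie_algebra (@circ K L) -> wedge c (commutator (ad x) (ad y) b) = 0.
Proof.
move=> two_neq0 Zc [_ _ _ /(_ x y (wedge c b))].
rewrite !(circC (wedge c b)) !circ_wedge_centre // -linearN circ_wedge_centre //.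
rewrite ad_circ // linearN !linearZ /= !linearN !linearZ /=.
set W := wedge c (commutator _ _ _).
rewrite -!scalerDr -linearB -[ad x _ - _]/(commutator (ad x) (ad y) b) -/W.
rewrite -[- W]scaleN1r -scalerDl scalerA => /eqP; rewrite scaler_eq0.
have -> : 2%:R^-1 - 1 = - 2%:R^-1 :> K.
  by apply: (mulfI two_neq0); rewrite mulrBr mulrN divff // mulr1 mulr2n opprD addNKr.
by rewrite mulrN oppr_eq0 mulf_eq0 invr_eq0 (negPf two_neq0) => /eqP.
Qed.
End CircTheory.

Theorem proposition3p6 (K : fieldType) (charK : 2%N \notin [pchar K])
    (L : threeLieType K)
    (nonabelian : ~ is_abelian (@commutator K L) (@InnDer K L))
    (dimZ : dim_ge (@centre K L) 2) :
  ~ is_lie_algebra (@circ K L).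
Proof.
have two_neq0 : (2%:R : K) != 0 by move: charK; rewrite inE.
(* By [InnDerE] every inner derivation is a single [ad x], so no linear combinations have to be
   handled. *)
move=> lie; apply: nonabelian; rewrite InnDerE => _ _ [x _ <-] [y _ <-].
apply/funext => b.
have [c [d [Zc Zd cd_free]]] := dim_ge2_indep dimZ.
have c0 : c != 0.
  apply/eqP => c0; have [|/eqP + _] := cd_free 1 0; last by rewrite oner_eq0.
  by rewrite c0 scaler0 scale0r addr0.
have d0 : d != 0.
  apply/eqP => d0; have [|_ /eqP] := cd_free 0 1; last by rewrite oner_eq0.
  by rewrite d0 scaler0 scale0r addr0.
have [k kc] := wedge_eq0_colinear c0 (jacobi_wedge_centre x y b two_neq0 Zc lie).
have [l ld] := wedge_eq0_colinear d0 (jacobi_wedge_centre x y b two_neq0 Zd lie).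
(* The same vector equals [k *: c] and [l *: d], so their difference is a vanishing combination of
   [c] and [d]. *)
have [|k0 _] := cd_free k (- l); first by rewrite -kc scaleNr -ld subrr.
by rewrite kc k0 scale0r.
Qed.
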